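(* Let $\kappa\ge\aleph_2$ be a regular cardinal and $T\subseteq\kappa$ stationary. Suppose there exists a $\sqsubseteq^*$-coherent $C$-sequence $\langle e_\delta\mid\delta<\kappa\rangle$ such that for every club $D\subseteq\kappa$ there is $\delta<\kappa$ with $\sup(\mathrm{nacc}(e_\delta)\cap D\cap T)=\delta$. Then for every stationary $S\subseteq\kappa$ there exists a $\sqsubseteq^*$-coherent $C$-sequence $\langle C_\delta\mid\delta<\kappa\rangle$ such that for every club $D\subseteq\kappa$ there is $\delta\in S$ with $\sup(\mathrm{nacc}(C_\delta)\cap D\cap T)=\delta$.
   Context: For a set of ordinals $A$: $\mathrm{ssup}(A)=\sup\{\alpha+1\mid\alpha\in A\}$, $\mathrm{acc}^+(A)=\{\alpha<\mathrm{ssup}(A)\mid\sup(A\cap\alpha)=\alpha>0\}$, $\mathrm{acc}(A)=A\cap\mathrm{acc}^+(A)$, $\mathrm{nacc}(A)=A\setminus\mathrm{acc}(A)$. A $C$-sequence over $\kappa$ is $\langle C_\delta\mid\delta<\kappa\rangle$ where each $C_\delta$ is a closed subset of $\delta$ with $\sup(C_\delta)=\sup(\delta)$. It is $\sqsubseteq^*$-coherent if for all $\delta<\kappa$ and $\bar\delta\in\mathrm{acc}(C_\delta)$, $\sup(C_{\bar\delta}\triangle(C_\delta\cap\bar\delta))<\bar\delta$. *)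

(* Defs.v *)
From mathcomp Require Import all_boot all_order.
From mathcomp Require Import boolp classical_sets functions cardinality wochoice.

Set Implicit Arguments.
Unset Strict Implicit.
Unset Printing Implicit Defensive.

Local Open Scope classical_set_scope.
Local Open Scope card_scope.
Local Open Scope order_scope.

(* A cardinal kappa is represented by a well-ordered type K of order type kappa:
   the ordinals below kappa are the elements of K, subsets of kappa are the
   A : set K, and an ordinal delta < kappa, viewed as the set of its
   predecessors, is [below delta].

   [supremums A s] is the library's "s = sup(A)"; as K is well-ordered, the
   supremum of a bounded set exists and is unique, sup(set0) is the least
   element 0 of K, and sup(beta + 1) = beta. *)

Section Ordinals.
Context {d : Order.disp_t} {K : orderType d}.
Implicit Types (A C D S T : set K) (alpha beta delta : K).

Definition below delta : set K := [set alpha | alpha < delta].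

Definition nonzero alpha : Prop := exists beta, beta < alpha.

(* Ordinals <= kappa are initial segments of K, so that beta + 1 is
   [set alpha | alpha <= beta] and suprema are unions; ssup(A) may be kappa,
   i.e. setT. *)
Definition ssup A : set K := \bigcup_(beta in A) [set alpha | alpha <= beta].

(* sup(A) = alpha > 0 *)
Definition positive_sup A alpha : Prop := supremums A alpha /\ nonzero alpha.

Definition accp A : set K :=
  [set alpha | ssup A alpha /\ positive_sup (A `&` below alpha) alpha].

Definition acc A : set K := A `&` accp A.

Definition nacc A : set K := A `\` acc A.

(* A is a closed subset of the ordinal E <= kappa in the order topology of E.
   The condition alpha \in E, and not just alpha < ssup(A), is what is needed:
   omega is not closed in omega + 1. *)
Definition closed_subset E A : Prop :=
  A `<=` E /\
  forall alpha, E alpha -> positive_sup (A `&` below alpha) alpha -> A alpha.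

Definition club D : Prop := closed_subset setT D /\ ~ has_ubound D.

Definition stationary S : Prop := forall D, club D -> S `&` D !=set0.

Definition C_sequence (C : K -> set K) : Prop :=
  forall delta, closed_subset (below delta) (C delta) /\
    exists2 s, supremums (C delta) s & supremums (below delta) s.

Definition coherent (C : K -> set K) : Prop :=
  forall delta delta', acc (C delta) delta' ->
    exists2 s, supremums (C delta' `+` (C delta `&` below delta')) s
             & s < delta'.

(* For every club D there is delta \in S with
   sup(nacc(C_delta) `&` D `&` T) = delta. The equation is read as cofinality in
   delta, so delta = 0, for which it would hold vacuously (sup(set0) = 0), is
   excluded; it never holds at successors. *)
Definition guesses_clubs (C : K -> set K) S T : Prop :=
  forall D, club D ->
    exists2 delta, S delta & positive_sup (nacc (C delta) `&` D `&` T) delta.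

End Ordinals.

(* Infinite regular cardinals: an initial ordinal each of whose cofinal subsets
   has full cardinality, i.e. cf(kappa) = kappa. *)
Definition regular_cardinal {d : Order.disp_t} (K : orderType d) : Prop :=
  [/\ well_order (<=%O : rel K),
      infinite_set [set: K],
      forall delta : K, ~ ([set: K] #<= below delta)
    & forall A : set K, ~ has_ubound A -> [set: K] #<= A].

(* |X| = aleph_n, where aleph_(n+1) is the successor cardinal of aleph_n. *)
Fixpoint has_card_aleph {U : Type} (n : nat) (X : set U) : Prop :=
  if n is m.+1 then
    exists Y : set U,
      [/\ Y `<=` X, has_card_aleph m Y, ~ (X #<= Y)
        & forall Z : set U, Z `<=` X -> ~ (X #<= Z) -> Z #<= Y]
  else X #= [set: nat].

(* aleph_n <= kappa *)
Definition card_ge_aleph (U : Type) (n : nat) : Prop :=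
  exists X : set U, has_card_aleph n X.

(* Main.v *)
(** For a set [X], refine each [e_delta] by walking along it: every [b] in
    [e_delta] owns the gap of ordinals below or equal to [b] that lie above all
    smaller elements of [e_delta]. If [X] meets the gap, replace [b] by
    [g = sup (X /\ gap)]; if moreover [g] is not in [X] (so it is a limit of [X]),
    fill the gap with the part of the refined [C_g] it contains. As each filling
    copies a refined ladder, the result [refine e X] is again coherent.

    Suppose that no [refine e (D /\ T)] guesses on [S], and choose for each [D] a
    club [E D] that defeats it. Let [D_i] ([i < omega_1]) and [D'_n] ([n < omega])
    be decreasing with [D_(i+1) <= E D_i] and [D'_(n+1) <= E D'_n], let [DD] be
    the intersection of all these clubs (a club, since kappa >= aleph_2), and pick
    [delta] in [S] that is a limit of points [t] at which [e] guesses [DD]. On the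
    walk from [delta] to such a [t], the suprema [g] decrease as the parameter
    shrinks, hence stabilize; so from some index on the refined ladder at [delta]
    has a good [nacc] point above any given ordinal below [t]. If no fixed [n]
    serves cofinally many such ordinals, then [cf delta = omega], and then a
    countable supremum of indices [i < omega_1] serves all of them. *)
Require Import Defs.
From mathcomp Require Import all_boot all_order.
From mathcomp Require Import boolp classical_sets cardinality wochoice.
Import Order.TTheory.

Set Implicit Arguments.
Unset Strict Implicit.
Unset Printing Implicit Defensive.

Local Open Scope order_scope.
Local Open Scope classical_set_scope.
Local Open Scope card_scope.

(** * Limit points and suprema in a well-ordered type *)

Section WellOrder.
Context {d : Order.disp_t} {K : orderType d}.
Hypothesis Kwo : well_order (<=%O : rel K).
Implicit Types (A B C D S T X Y : set K) (a b c x y z : K).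

Lemma wo_min A : A !=set0 -> exists2 m, A m & forall a, A a -> m <= a.
Proof.
move=> [a Aa]; have [|m [[mA mmin] _]] := Kwo (A := [pred x | `[< A x >]]).
  by exists a; apply/asboolP.
exists m; first exact/asboolP.
by move=> b Ab; apply: mmin; apply/asboolP.
Qed.

Lemma wo_ind (P : K -> Prop) :
  (forall a, (forall b, b < a -> P b) -> P a) -> forall a, P a.
Proof.
move=> IH a; apply: contrapT => nPa.
have [m nPm mmin] : exists2 m, ~ P m & forall b, ~ P b -> m <= b.
  by apply: wo_min; exists a.
apply: nPm; apply: IH => b bm; apply: contrapT => /mmin.
by rewrite leNgt bm.
Qed.

Lemma wo_wf : well_founded (fun a b : K => a < b).
Proof. by move=> a; elim/wo_ind: a => a IH; constructor. Qed.

(* [a] is a positive limit of [A]; membership of [a] in [A] is not required. *)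
Definition limpt A a := nonzero a /\ forall b, b < a -> exists c, [/\ A c, b < c & c < a].

Lemma positive_supE A a : positive_sup (A `&` below a) a <-> limpt A a.
Proof.
split=> [[[ubA lubA] a0]|[a0 lA]]; split=> //.
  move=> b ba; apply: contrapT => nA.
  suff /lubA : ubound (A `&` below a) b by rewrite leNgt ba.
  move=> x [Ax xa]; rewrite leNgt; apply/negP => bx.
  by apply: nA; exists x.
split=> [x [_ /ltW]//|b ubb]; rewrite leNgt; apply/negP => /lA[c [Ac bc ca]].
by move: (ubb c (conj Ac ca)); rewrite leNgt bc.
Qed.

Lemma positive_sup_below A a : A `<=` below a -> positive_sup A a <-> limpt A a.
Proof. by move=> Aa; rewrite -positive_supE (setIidl Aa). Qed.

Lemma accE A a : acc A a <-> A a /\ limpt A a.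
Proof.
split=> [[Aa [_ /positive_supE lA]]|[Aa lA]]; first by [].
by split=> //; split; [exists a => /= | apply/positive_supE].
Qed.

Lemma naccE A a : nacc A a <-> A a /\ ~ limpt A a.
Proof.
split=> [[Aa nacA]|[Aa nlA]]; split=> //.
  by move=> lA; apply: nacA; apply/accE.
by move/accE => -[].
Qed.

Lemma limpt_tail A B a b : b < a -> (forall c, b < c -> c < a -> A c -> B c) ->
  limpt A a -> limpt B a.
Proof.
move=> ba AB [a0 lA]; split=> // c ca.
have [|x [Ax]] := lA (Order.max b c); first by rewrite gt_max ba ca.
rewrite gt_max => /andP[bx cx] xa; exists x; split=> //; exact: AB.
Qed.

Lemma limpt_sub A B a : A `<=` B -> limpt A a -> limpt B a.
Proof.
move=> AB [a0 lA]; split=> // c /lA[x [Ax ? ?]]; exists x; split=> //; exact: AB.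
Qed.

Lemma sup_exists A b : ubound A b ->
  exists s, [/\ supremums A s, s <= b & forall x, x < s -> exists2 a, A a & x < a].
Proof.
move=> ubb; have [s us smin] : exists2 s, ubound A s & forall a, ubound A a -> s <= a.
  by apply: wo_min; exists b.
exists s; split; [by [] | exact: smin | move=> x xs].
apply: contrapT => nA; suff /smin : ubound A x by rewrite leNgt xs.
by move=> a Aa; rewrite leNgt; apply/negP => xa; apply: nA; exists a.
Qed.

(** * Ladders [e δ] and their gaps *)

Section Construction.
Variables (e : K -> set K) (eC : C_sequence e) (eco : coherent e).

Lemma e_below δ a : e δ a -> a < δ.
Proof. by have [[sub _] _] := eC δ; apply: sub. Qed.

Lemma e_closed δ a : a < δ -> limpt (e δ) a -> e δ a.
Proof. by have [[_ cl] _] := eC δ => ad /positive_supE; apply: cl. Qed.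


Lemma e_cofinal δ : limpt setT δ -> limpt (e δ) δ.
Proof.
move=> [δ0 lδ]; split=> // b bδ; have [_ [s [_ lubs] [ubs _]]] := eC δ.
apply: contrapT => nA; have /lubs sb : ubound (e δ) b.
  move=> x ex; rewrite leNgt; apply/negP => bx.
  by apply: nA; exists x; split=> //; apply: e_below.
have [c [_ bc cδ]] := lδ _ bδ.
by have := lt_le_trans bc (le_trans (ubs c cδ) sb); rewrite ltxx.
Qed.

(** By closedness a limit of [e δ] below [δ] lies in [acc (e δ)], where coherence bounds the
    symmetric difference below [a]. *)
Lemma e_tail δ a : a < δ -> limpt (e δ) a ->
  exists2 b, b < a & forall x, b < x -> x < a -> e δ x <-> e a x.
Proof.
move=> ad la; have [|s [ub _] sa] := eco (delta := δ) (delta' := a).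
  by apply/accE; split=> //; apply: e_closed.
exists s => // x sx xa; split=> ex; apply: contrapT => nex.
  by have /ub : (e a `+` (e δ `&` below a)) x; [right|rewrite leNgt sx].
by have /ub : (e a `+` (e δ `&` below a)) x; [left; split=> // -[]|rewrite leNgt sx].
Qed.

(* When [b] is a limit of [e δ], its gap is the singleton [b], so [refine] below
   keeps accumulation points without a separate clause. *)
Definition gap δ b : set K := [set a | a <= b /\ forall x, e δ x -> x < b -> x < a].

Lemma gap_uniq δ b b' a : e δ b -> e δ b' -> gap δ b a -> gap δ b' a -> b = b'.
Proof.
move=> eb eb' [ab ga] [ab' ga']; case: (ltgtP b b') => // bb.
  by move: (ga' _ eb bb); rewrite ltNge ab.
by move: (ga _ eb' bb); rewrite ltNge ab'.
Qed.

Lemma gap_exists δ a : limpt setT δ -> a < δ -> exists2 b, e δ b & gap δ b a.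
Proof.
move=> lδ aδ; have [b [eb ab] bmin] :
    exists2 b, (e δ b /\ a <= b) & forall c, (e δ c /\ a <= c) -> b <= c.
  apply: wo_min; have [_ /(_ a aδ)[c [ec ac _]]] := e_cofinal lδ.
  by exists c; split=> //; apply: ltW.
exists b => //; split=> // x ex; apply: contraTT; rewrite -!leNgt => ax.
exact: bmin.
Qed.

Lemma gap_limpt δ b : limpt (e δ) b -> forall a, gap δ b a -> a = b.
Proof.
move=> [_ lb] a [ab ga]; apply/eqP; rewrite eq_le ab leNgt; apply/negP => /lb[c [ec ac cb]].
by move: (ga _ ec cb); rewrite ltNge (ltW ac).
Qed.

(** As [a] is not a limit of [e δ], some [c < a] has no point of the ladder strictly between it and
    [a]. *)
Lemma gap_tail δ b a : e δ b -> gap δ b a -> nonzero a -> ~ limpt (e δ) a ->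
  exists2 c, c < a & forall x, c < x -> x <= a -> gap δ b x.
Proof.
move=> eb [ab ga] a0 nla.
have [c ca nc] : exists2 c, c < a & forall x, c < x -> x < a -> ~ e δ x.
  apply: contrapT => H; apply: nla; split=> // c ca; apply: contrapT => H'.
  by apply: H; exists c => // x cx xa ex; apply: H'; exists x.
exists c => // x cx xa; split; first exact: le_trans ab.
move=> y ey yb; have ya := ga _ ey yb; apply: le_lt_trans cx.
by rewrite leNgt; apply/negP => cy; apply: (nc y).
Qed.

(** The common point [c'] shields the gap: every element of it lies above [c'], hence above whatever
    the ladders do at or below [c]. *)
Lemma gap_local δ δ' a c c' b x : e δ c' -> e δ' c' -> c < c' -> c' < b -> b < a ->
  (forall y, c < y -> y < a -> e δ y <-> e δ' y) ->
  gap δ b x -> gap δ' b x.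
Proof.
move=> ec' e'c' cc cb ba H [xb gx]; split=> // y ey yb.
case: (ltP c y) => cy; first by apply: gx => //; apply/H => //; apply: lt_trans ba.
by apply: le_lt_trans cy _; apply: lt_trans cc _; apply: gx.
Qed.

(** * The refined ladder: closedness and coherence *)

Section Refinement.
Variable X : set K.

Definition rep δ b g : Prop :=
  (X `&` gap δ b = set0 /\ g = b) \/
  (X `&` gap δ b !=set0 /\ supremums (X `&` gap δ b) g).

Lemma rep_gap δ b g : e δ b -> rep δ b g -> gap δ b g.
Proof.
move=> eb [[_ ->]|[[x [Xx gx]] [ubg lubg]]]; first by split=> //; rewrite lexx.
split; first by apply: lubg => y [_ []].
by move=> y ey yb; apply: lt_le_trans (ubg x (conj Xx gx)); apply: gx.2.
Qed.

Lemma rep_exists δ b : exists g, rep δ b g.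
Proof.
have [E|/set0P NE] := eqVneq (X `&` gap δ b) set0; first by exists b; left.
have [|s [ss _ _]] := @sup_exists (X `&` gap δ b) b; first by move=> y [_ []].
by exists s; right.
Qed.

Lemma rep_uniq δ b g g' : rep δ b g -> rep δ b g' -> g = g'.
Proof.
move=> [[E ->]|[N s]] [[E' ->]|[N' s']] //.
- by move: N'; rewrite E => -[].
- by move: N; rewrite E' => -[].
- exact: is_subset1_supremums s s'.
Qed.

Lemma rep_mem δ b : e δ b -> X b -> rep δ b b.
Proof.
move=> eb Xb; have gb : gap δ b b by split=> //; rewrite lexx.
right; split; first by exists b.
by split=> [x [_ []]//|x]; apply.
Qed.

(* [RefinePred] makes [refine δ] the singleton of the predecessor at successor [δ]. *)
Inductive refine : K -> K -> Prop :=
| RefinePred δ a : a < δ -> (forall x, x < δ -> x <= a) -> refine δ a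
| RefineRep δ b g : limpt setT δ -> e δ b -> rep δ b g -> refine δ g
| RefineFill δ b g a : limpt setT δ -> e δ b -> rep δ b g -> ~ X g ->
    limpt X g -> gap δ b a -> a < g -> refine g a -> refine δ a.

Lemma refine_below δ a : refine δ a -> a < δ.
Proof.
case=> {δ a} [//|δ b g lδ eb /(rep_gap eb)[gb _]|δ b g a lδ eb _ _ _ [ab _] _ _];
  exact: le_lt_trans (e_below eb).
Qed.

(** Gaps of distinct ladder points are disjoint, so only the rules for this [b] can produce [a];
    [RefinePred] never applies at a limit. *)
Lemma refine_gapE δ b a : limpt setT δ -> e δ b -> gap δ b a ->
  refine δ a <-> exists2 g, rep δ b g & a = g \/ [/\ ~ X g, limpt X g, a < g & refine g a].
Proof.
move=> lδ eb ga; split=> [r|[g rg [->|[Xg lg ag r]]]]; last 2 first.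
- exact: RefineRep rg.
- exact: (RefineFill lδ eb rg).
case: r lδ eb ga => {δ a} [δ a aδ mx|δ b' g _ eb' rg|δ b' g a _ eb' rg Xg lg ga' ag rga] lδ eb ga.
- have [_ /(_ _ aδ)[c [_ ac cδ]]] := lδ.
  by move: (mx _ cδ); rewrite leNgt ac.
- have bb := gap_uniq eb' eb (rep_gap eb' rg) ga; rewrite bb in rg.
  by exists g => //; left.
- have bb := gap_uniq eb' eb ga' ga; rewrite bb in rg.
  by exists g => //; right.
Qed.

Lemma refine_cofinal δ : limpt setT δ -> limpt (refine δ) δ.
Proof.
move=> lδ; split; first by case: lδ.
have [_ le] := e_cofinal lδ; move=> x /le[b [eb xb /le[b' [eb' bb' b'δ]]]].
have [g rg] := rep_exists δ b'; have [gb' gg] := rep_gap eb' rg.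
exists g; split; first exact: RefineRep rg.
  exact: lt_trans xb (gg _ eb bb').
exact: le_lt_trans b'δ.
Qed.

(** Closedness and coherence go through one induction on [δ]. At a limit of [e δ], the ladders,
    hence the gaps and representatives, agree on a tail. Any other [a] has a tail inside a single
    gap, where [refine δ] copies [refine g] for some [g < δ]. *)
Lemma refine_tail δ : forall a, a < δ -> limpt (refine δ) a ->
  refine δ a /\ exists2 b, b < a & forall x, b < x -> x < a -> refine δ x <-> refine a x.
Proof.
elim/wo_ind: δ => δ IH a aδ la.
(* For [δ] zero or a successor, [refine δ] contains at most the predecessor of [δ], so it has no
   limit [a < δ]. *)
have [lδ|nlδ] := pselect (limpt setT δ); last first.
  have [b ba] := la.1; have [x [rx _ xa]] := la.2 _ ba.
  case: rx aδ xa nlδ => {δ x IH la} // δ x _ mx aδ xa _.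
  by move: (mx _ aδ); rewrite leNgt xa.
have la' : limpt setT a by apply: limpt_sub la.
have [b eb gb] := gap_exists lδ aδ.
have [lea|nlea] := pselect (limpt (e δ) a).
  have eda := e_closed aδ lea; split.
    have ga : gap δ a a by split=> //; rewrite lexx.
    have [g rg] := rep_exists δ a.
    by rewrite -(gap_limpt lea (rep_gap eda rg)); apply: RefineRep rg.
  have [c ca ce] := e_tail aδ lea.
  have [_ le] := lea.
  (* [c1] lies in both ladders and serves as the shielding point of [gap_local]. *)
  have [c1 [ec1 cc1 c1a]] := le _ ca; have [c2 [ec2 c12 c2a]] := le _ c1a.
  have e'c1 := (ce _ cc1 c1a).1 ec1.
  exists c2 => // x c2x xa.
  have [b' eb' gb'] := gap_exists lδ (lt_trans xa aδ).
  have xb' := gb'.1.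
  have b'a : b' < a.
    rewrite ltNge; apply/negP => ab'; have [y [ey xy ya]] := le _ xa.
    by move: (gb'.2 _ ey (lt_le_trans ya ab')); rewrite ltNge (ltW xy).
  have c2b' := lt_le_trans c2x xb'.
  have eab' : e a b' by apply/ce => //; apply: lt_trans c2b'; apply: lt_trans c12.
  have gE : gap δ b' = gap a b'.
    apply/seteqP; split=> y; apply: (gap_local (a := a) (c := c) (c' := c1)) => //.
    - exact: lt_trans c2b'.
    - exact: lt_trans c2b'.
    - by move=> z cz za; rewrite ce.
  have gab' : gap a b' x by rewrite -gE.
  by rewrite (refine_gapE lδ eb' gb') (refine_gapE la' eab' gab') /rep gE.
have [c ca cg] := gap_tail eb gb la.1 nlea.
have [g rg] := rep_exists δ b.
have F x : c < x -> x <= a -> refine δ x <-> x = g \/ [/\ ~ X g, limpt X g, x < g & refine g x].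
  move=> cx xa; rewrite (refine_gapE lδ eb (cg _ cx xa)); split=> [[g' rg']|]; last by exists g.
  by rewrite (rep_uniq rg' rg).
have lt_g x : c < x -> x <= a -> refine δ x -> x <= g.
  by move=> cx xa; rewrite F// => -[->//|[_ _ /ltW]].
have ag : a <= g.
  rewrite leNgt; apply/negP => ga; have [_ /(_ (Order.max c g))[]] := la.
    by rewrite gt_max ca ga.
  move=> x [rx]; rewrite gt_max => /andP[cx gx] xa.
  by move: (lt_g x cx (ltW xa) rx); rewrite leNgt gx.
(* Since [a <= g], a point of [refine δ] between [c] and [a] is not [g], so it comes from a filling;
   this forces the conditions on [X] and [g]. *)
have [x [rx cx xa]] := la.2 _ ca.
have [Xg lg] : ~ X g /\ limpt X g.
  move: rx; rewrite F ?ltW// => -[xg|[]//].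
  by move: xa; rewrite xg ltNge ag.
have F' y : c < y -> y < a -> refine δ y <-> refine g y.
  move=> cy ya; rewrite F ?ltW//; have yg := lt_le_trans ya ag; split=> [[yg'|[]//]|].
    by move: yg; rewrite yg' ltxx.
  by right.
have gδ : g < δ by apply: le_lt_trans (rep_gap eb rg).1 (e_below eb).
have [ag'|ag'] := eqVneq a g.
  split; first by apply/F => //; left.
  by exists c => // y cy ya; rewrite ag'; apply: F'.
have ag'' : a < g by rewrite lt_neqAle ag'.
have [|rga [c' c'a rr]] := IH g gδ a ag''.
  by apply: (limpt_tail ca) la => y cy ya /F'; apply.
split; first by apply/F => //; right.
exists (Order.max c c'); first by rewrite gt_max ca.
move=> y; rewrite gt_max => /andP[cy c'y] ya.
by rewrite F'// rr.
Qed.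

Lemma refine_nlimpt δ : ~ limpt setT δ ->
  exists2 s, supremums (refine δ) s & supremums (below δ) s.
Proof.
move=> nlδ; have [δ0|nδ0] := pselect (nonzero δ); last first.
  have min x : δ <= x by rewrite leNgt; apply/negP => ?; apply: nδ0; exists x.
  by exists δ; split=> x //; [move/refine_below/ltW|move/ltW].
have [b bδ nb] : exists2 b, b < δ & forall x, x < δ -> x <= b.
  apply: contrapT => H; apply: nlδ; split=> // b bδ; apply: contrapT => H'.
  apply: H; exists b => // x xδ; rewrite leNgt; apply/negP => bx.
  by apply: H'; exists x.
exists b; split=> x; first by move/refine_below/nb.
- by apply; apply: RefinePred.
- exact: nb.
- by apply.
Qed.

Lemma refine_C_sequence : C_sequence refine.
Proof.
move=> δ; split.
  split; first by move=> a; apply: refine_below.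
  by move=> a aδ /positive_supE la; have [] := refine_tail aδ la.
have [lδ|/refine_nlimpt//] := pselect (limpt setT δ).
have /(positive_sup_below (@refine_below δ))[s1 _] := refine_cofinal lδ.
have /positive_supE[s2 _] := lδ; rewrite setTI in s2.
by exists δ.
Qed.

Lemma refine_coherent : coherent refine.
Proof.
move=> δ a /accE[ra la]; have aδ := refine_below ra.
have [_ [b ba H]] := refine_tail aδ la.
have ub : ubound (refine a `+` (refine δ `&` below a)) b.
  move=> x sx; rewrite leNgt; apply/negP => bx.
  by case: sx => [[rx nx]|[[rx xa] nx]]; apply: nx;
    [have xa := refine_below rx; split=> //|]; apply/H.
have [s [ss sb _]] := sup_exists ub.
by exists s => //; apply: le_lt_trans ba.
Qed.

(** * Nonaccumulation points of refined ladders *)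

Lemma rep_nacc δ b g : limpt setT δ -> e δ b -> ~ limpt (e δ) b -> rep δ b g ->
  X g -> nacc (refine δ) g.
Proof.
move=> lδ eb nlb rg Xg; have gg := rep_gap eb rg; apply/naccE; split.
  exact: RefineRep rg.
move=> lg; have gδ := le_lt_trans gg.1 (e_below eb).
(* A limit of [e δ] is the only point of its own gap, which would make [b = g]. Otherwise a tail
   below [g] lies in the gap of [b], where [g] in [X] leaves no other refined point. *)
apply: nlb; suff leg : limpt (e δ) g.
  suff -> : b = g by [].
  by apply: (gap_uniq eb (e_closed gδ leg)) gg _; split=> //; rewrite lexx.
apply: contrapT => nleg.
have [c cg cgap] := gap_tail eb gg lg.1 nleg.
have [x [rx cx xg]] := lg.2 _ cg.
move: rx; rewrite (refine_gapE lδ eb (cgap _ cx (ltW xg))) => -[g' rg'].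
rewrite (rep_uniq rg' rg) => -[xg'|[]//].
by move: xg; rewrite xg' ltxx.
Qed.

Lemma fill_nacc δ b g a : limpt setT δ -> e δ b -> ~ limpt (e δ) a -> rep δ b g -> ~ X g ->
    limpt X g -> gap δ b a -> a < g -> nacc (refine g) a -> nacc (refine δ) a.
Proof.
move=> lδ eb nlea rg Xg lg ga ag /naccE[ra nla]; apply/naccE; split.
  exact: (RefineFill lδ eb rg).
move=> la; apply: nla.
have [c cg cgap] := gap_tail eb ga la.1 nlea.
apply: (limpt_tail cg) la => x cx xa.
rewrite (refine_gapE lδ eb (cgap _ cx (ltW xa))) => -[g' rg'].
rewrite (rep_uniq rg' rg) => -[xg'|[]//].
by move: xa; rewrite xg' ltNge (ltW ag).
Qed.

End Refinement.

(* Walk from [δ] down to [t]; [g] is the least of the suprema attached to the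
   members of [F], and it is attained by all small enough members. Either all of
   these contain [g], which is then the required point, or the walk continues at
   [g < δ]. *)
Lemma chain_refine_nacc (F : set (set K)) : F !=set0 ->
  (forall X Y, F X -> F Y -> X `<=` Y \/ Y `<=` X) ->
  forall t, limpt (nacc (e t) `&` \bigcap_(X in F) X) t ->
  forall δ, t <= δ -> limpt setT δ -> forall a, a < t ->
  exists2 X, F X & forall Y, F Y -> Y `<=` X ->
    exists x, [/\ nacc (refine Y δ) x, (\bigcap_(X in F) X) x, a < x & x < δ].
Proof.
move=> [X0 FX0] Fc t lt; elim/wo_ind => δ IH tδ lδ a at_.
have lT Y : F Y -> limpt Y t by move=> FY; apply: limpt_sub lt => x [_ /(_ Y FY)].
have [H|H] := pselect (exists x, [/\ nacc (e δ) x, (\bigcap_(X in F) X) x, a < x & x < δ]).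
  have [x [/naccE[ex nlx] Fx ax xδ]] := H.
  exists X0 => // Y FY _; exists x; split=> //.
  exact: rep_nacc (rep_mem ex (Fx Y FY)) (Fx Y FY).
(* If [e δ] agreed with [e t] on a tail of [t], it would inherit the nonaccumulation points of
   [e t]. Hence [t] is neither [δ] nor a limit of [e δ]. *)
have nt c : c < t -> ~ forall x, c < x -> x < t -> e δ x <-> e t x.
  move=> ct E; apply: H; have [_ /(_ (Order.max a c))[|x [[/naccE[ex nlx] Fx]]]] := lt.
    by rewrite gt_max at_ ct.
  rewrite gt_max => /andP[ax cx] xt; exists x; split=> //; last exact: lt_le_trans tδ.
  apply/naccE; split; first by apply/E.
  move=> lx; apply: nlx; apply: (limpt_tail cx) lx => y cy yx.
  by apply: (E _ _ _).1 => //; apply: lt_trans xt.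
have {}tδ : t < δ.
  rewrite lt_neqAle tδ andbT; apply/eqP => tE.
  by apply: (nt a) => // x _ _; rewrite tE.
have nlet : ~ limpt (e δ) t by move=> let_; have [c ct] := e_tail tδ let_; apply: nt.
have [b eb gt] := gap_exists lδ tδ.
have [c ct cgap] := gap_tail eb gt lt.1 nlet.
have ec y : e δ y -> y < b -> y <= c.
  move=> ey yb; rewrite leNgt; apply/negP => cy.
  by have [_ /(_ _ ey yb)] := cgap _ cy (ltW (gt.2 _ ey yb)); rewrite ltxx.
have nleb : ~ limpt (e δ) b.
  by move=> leb; apply: nlet; rewrite (gap_limpt leb gt).
have NE Y : F Y -> Y `&` gap δ b !=set0.
  move=> /lT[_ /(_ _ ct)[x [Yx cx xt]]]; exists x; split=> //.
  by apply: cgap => //; apply: ltW.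
have [g [X1 FX1 rg] gmin] : exists2 g, (exists2 Y, F Y & rep Y δ b g) &
    forall h, (exists2 Y, F Y & rep Y δ b h) -> g <= h.
  by apply: wo_min; have [g rg] := rep_exists X0 δ b; exists g; exists X0.
have rep_min Y : F Y -> Y `<=` X1 -> rep Y δ b g.
  move=> FY YX; have [h rh] := rep_exists Y δ b; suff -> : g = h by [].
  apply/eqP; rewrite eq_le gmin; last by exists Y.
  case: rh => [[E]|[_ [_ lub]]]; first by move: (NE _ FY); rewrite E => -[].
  apply: lub => x [Yx gx]; case: rg => [[E]|[_ [ub _]]].
    by move: (NE _ FX1); rewrite E => -[].
  by apply: ub; split=> //; apply: YX.
have gb := rep_gap eb rg.
have gδ : g < δ := le_lt_trans gb.1 (e_below eb).
have tg : t <= g.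
  case: (rg) => [[E]|[_ [ub _]]]; first by move: (NE _ FX1); rewrite E => -[].
  rewrite leNgt; apply/negP => gt'; have [_ /(_ (Order.max g c))[]] := lT _ FX1.
    by rewrite gt_max ct gt'.
  move=> x [Xx]; rewrite gt_max => /andP[gx cx] xt.
  have : x <= g by apply: ub; split=> //; apply: cgap => //; apply: ltW.
  by rewrite leNgt gx.
have [allg|] := pselect (forall Y, F Y -> Y `<=` X1 -> Y g).
  exists X1 => // Y FY YX; exists g; split=> //; last exact: lt_le_trans tg.
    exact: rep_nacc (rep_min _ FY YX) (allg _ FY YX).
  move=> Z FZ; have [ZX|XZ] := Fc _ _ FZ FX1; first exact: allg.
  by apply: XZ; apply: allg.
(* Once [X2] omits [g], every member of [F] inside [X2] has [g] as an unattained supremum, so the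
   gap is filled from [refine g]. *)
move=> /existsNP[X2 /not_implyP[FX2 /not_implyP[X21 nX2g]]].
have lgY Y : F Y -> Y `<=` X2 -> limpt Y g.
  move=> FY YX; have nYg : ~ Y g by move=> /YX.
  case: (rep_min _ FY (subset_trans YX X21)) => [[E]|[_ [ub lub]]].
    by move: (NE _ FY); rewrite E => -[].
  split; first by have [z zt] := lt.1; exists z; apply: lt_le_trans tg.
  move=> y yg; apply: contrapT => H'; have /lub : ubound (Y `&` gap δ b) y.
    move=> x [Yx gx]; rewrite leNgt; apply/negP => yx; apply: H'; exists x; split=> //.
    rewrite lt_neqAle ub// andbT; apply/eqP => xg; apply: nYg; by rewrite -xg.
  by rewrite leNgt yg.
have lg : limpt setT g by apply: limpt_sub (lgY _ FX2 _).
(* Asking for points above [c] as well keeps them in the gap of [b] and away from the limits of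
   [e δ]. *)
have [|X3 FX3 HX3] := IH g gδ tg lg (Order.max a c).
  by rewrite gt_max at_ ct.
have [X4 FX4 [X42 X43]] : exists2 X4, F X4 & X4 `<=` X2 /\ X4 `<=` X3.
  by have [S|S] := Fc _ _ FX2 FX3; [exists X2|exists X3] => //; split=> // x.
exists X4 => // Y FY Y4.
have [x [nx Fx]] := HX3 Y FY (subset_trans Y4 X43).
rewrite gt_max => /andP[ax cx] xg; exists x; split=> //; last exact: lt_trans gδ.
have YX2 := subset_trans Y4 X42.
have gx : gap δ b x.
  split; first exact: ltW (lt_le_trans xg gb.1).
  by move=> y ey yb; apply: le_lt_trans cx; apply: ec.
apply: (fill_nacc lδ eb _ (rep_min _ FY (subset_trans YX2 X21)) _ (lgY _ FY YX2) gx xg nx).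
  move=> [_ /(_ _ cx)[y [ey cy yx]]].
  by move: (ec _ ey (lt_le_trans yx gx.1)); rewrite leNgt cy.
by move=> /YX2.
Qed.

Lemma antitone_refine_nacc (dI : Order.disp_t) (I : orderType dI) (W : set I)
    (G : I -> set K) A δ : W !=set0 ->
  (forall i j, i <= j -> G j `<=` G i) ->
  (forall t, A t -> limpt (nacc (e t) `&` \bigcap_(i in W) G i) t) ->
  limpt A δ -> forall a, a < δ ->
  exists2 i, W i & forall j, W j -> i <= j ->
    exists x, [/\ nacc (refine (G j) δ) x, (\bigcap_(i in W) G i) x, a < x & x < δ].
Proof.
move=> W0 anti AG lA a aδ; have [t [At at_ tδ]] := lA.2 _ aδ.
have F0 : G @` W !=set0 by have [i Wi] := W0; exists (G i); exists i.
have Fc X Y : (G @` W) X -> (G @` W) Y -> X `<=` Y \/ Y `<=` X.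
  move=> [i _ <-] [j _ <-].
  by case: (leP i j) => [|/ltW] /anti; [right|left].
have lt : limpt (nacc (e t) `&` \bigcap_(X in G @` W) X) t.
  by rewrite bigcap_image; apply: AG.
have lδ : limpt setT δ by apply: limpt_sub lA.
have [_ [i Wi <-] HX] := chain_refine_nacc F0 Fc lt (ltW tδ) lδ at_.
exists i => // j Wj ij; have [|x] := HX (G j) _ (anti _ _ ij); first by exists j.
by rewrite bigcap_image => Hx; exists x.
Qed.
End Construction.
End WellOrder.

(** * Clubs in a regular uncountable cardinal *)

Section Clubs.
Context {d : Order.disp_t} {K : orderType d}.
Hypothesis Kreg : regular_cardinal K.
Hypothesis Knomax : ~ has_ubound [set: K].
Implicit Types (A D S T : set K) (a b x δ : K).

Let Kwo : well_order (<=%O : rel K). Proof. by case: Kreg. Qed.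

Let Kcofinal A : ~ has_ubound A -> [set: K] #<= A.
Proof. by case: Kreg => _ _ _; apply. Qed.

Lemma nhas_uboundE A : ~ has_ubound A <-> forall u, exists2 x, A x & u < x.
Proof.
split=> [nA u|H [u uA]]; last by have [x /uA] := H u; rewrite leNgt => /negP.
apply: contrapT => H; apply: nA; exists u => x Ax; rewrite leNgt; apply/negP => ux.
by apply: H; exists x.
Qed.

Lemma clubE D : club D <->
  (forall a, limpt D a -> D a) /\ forall u, exists2 x, D x & u < x.
Proof.
rewrite /club nhas_uboundE; split=> -[H ?]; split=> //.
  by move=> a /positive_supE; apply: H.2.
by split=> // a _ /positive_supE; apply: H.
Qed.

Lemma small_bounded (I : Type) (A : set I) (f : I -> K) :
  ~ ([set: K] #<= A) -> exists b, forall i, A i -> f i < b.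
Proof.
move=> nKA; have [u uA] : has_ubound (f @` A).
  apply: contrapT => /Kcofinal Kf; apply: nKA.
  exact: card_le_trans Kf (card_image_le _ _).
have /nhas_uboundE/(_ u)[b _ ub] := Knomax; exists b => i Ai.
by apply: le_lt_trans ub; apply: uA; exists i.
Qed.

(** Take [Y] of size aleph_1. If bounded, it sits in some [below b], which is then uncountable; if
    unbounded, regularity gives it size kappa, contradicting aleph_2 <= kappa. *)
Lemma uncountable_below : card_ge_aleph K 2 -> exists w : K, ~ countable (below w).
Proof.
move=> [X [Y [_ [Y0 [_ cY0 nYY0 _]] nXY _]]].
apply: contrapT => H; have cb (w : K) : countable (below w).
  by apply: contrapT => cw; apply: H; exists w.
have [[u uY]|/Kcofinal KY] := pselect (has_ubound Y).
  have /nhas_uboundE/(_ u)[b _ ub] := Knomax; apply: nYY0.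
  have Yb : Y `<=` below b by move=> x /uY xu; apply: le_lt_trans ub.
  apply: card_le_trans (subset_card_le Yb) _.
  by apply: card_le_trans (cb b) _; rewrite (card_le_eqr cY0).
by apply: nXY; apply: card_le_trans KY; apply: card_leT.
Qed.

Hypothesis Kunc : ~ countable [set: K].

(** Closing off: iterate a choice function for [R] from [u] omega times; the supremum exists since
    kappa is regular and uncountable. *)
Lemma omega_closure (R : K -> K -> Prop) : (forall a, exists2 b, a < b & R a b) ->
  forall u, exists δ, [/\ u < δ, nonzero δ &
    forall x, x < δ -> exists a b, [/\ x < a, a < b, b < δ & R a b]].
Proof.
move=> HR u; have /choice[f fP] : forall a, exists b, a < b /\ R a b.
  by move=> a; have [b] := HR a; exists b.
pose s n := iter n f u.
have sS n : s n < s n.+1 by have [] := fP (s n).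
have [b sb] : exists b, forall n, [set: nat] n -> s n < b by apply: small_bounded.
have [|δ [[ub _] _ lδ]] := @sup_exists _ _ Kwo (range s) b.
  by move=> _ [n _ <-]; apply/ltW/sb.
have sδ n : s n < δ by apply: lt_le_trans (sS n) _; apply: ub; exists n.+1.
exists δ; split; [exact: (sδ 0%N) | by exists u; exact: (sδ 0%N) |].
move=> x /lδ[_ [n _ <-] xs]; exists (s n), (s n.+1); split=> //.
by have [] := fP (s n).
Qed.

Lemma club_bigcap (I : Type) (A : set I) (F : I -> set K) : ~ ([set: K] #<= A) ->
  (forall i, A i -> club (F i)) -> club (\bigcap_(i in A) F i).
Proof.
move=> nKA cF; apply/clubE; split.
  move=> a la i Ai; have /clubE[cl _] := cF i Ai; apply: cl.
  by apply: limpt_sub la => x; apply.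
pose R a b := forall i, A i -> exists x, [/\ F i x, a < x & x < b].
have HR a : exists2 b, a < b & R a b.
  have /choice[f fP] : forall i, exists x, A i -> F i x /\ a < x.
    move=> i; have [Ai|nAi] := pselect (A i); last by exists a.
    by have /clubE[_ /(_ a)[x]] := cF i Ai; exists x.
  have [b fb] := small_bounded f nKA.
  have /nhas_uboundE/(_ (Order.max a b))[c _] := Knomax.
  rewrite gt_max => /andP[ac bc]; exists c => // i Ai; have [? ?] := fP i Ai.
  by exists (f i); split=> //; apply: lt_trans bc; apply: fb.
move=> u; have [δ [uδ δ0 H]] := omega_closure HR u; exists δ => // i Ai.
have /clubE[cl _] := cF i Ai; apply: cl; split=> // x /H[a [b [xa ab bδ]]].
move=> /(_ i Ai)[y [Fy ay yb]]; exists y; split=> //.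
  exact: lt_trans ay.
exact: lt_trans bδ.
Qed.

Lemma club_setI D D' : club D -> club D' -> club (D `&` D').
Proof.
move=> cD cD'; pose F (b : bool) := if b then D else D'.
have <- : \bigcap_(b in [set: bool]) F b = D `&` D'.
  apply/seteqP; split=> [x H|x [Dx D'x] []//].
  by split; [exact: (H true) | exact: (H false)].
apply: club_bigcap => [Kb|[]//].
by apply: Kunc; apply: card_le_trans Kb (countableP _).
Qed.

Lemma club_limpt A : ~ has_ubound A -> club (limpt A).
Proof.
move=> /nhas_uboundE uA; apply/clubE; split.
  move=> a [a0 la]; split=> // b /la[c [lc bc ca]].
  have [x [Ax bx xc]] := lc.2 _ bc; exists x; split=> //; exact: lt_trans ca.
pose R a b := exists x, [/\ A x, a < x & x < b].
have HR a : exists2 b, a < b & R a b.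
  have [x Ax ax] := uA a; have [b _ xb] := uA x.
  by exists b; [exact: lt_trans xb | exists x].
move=> u; have [δ [uδ δ0 H]] := omega_closure HR u; exists δ => //; split=> //.
move=> x /H[a [b [xa _ bδ [y [Ay ay yb]]]]]; exists y; split=> //.
  exact: lt_trans ay.
exact: lt_trans bδ.
Qed.

Lemma club_above D u : club D -> club (D `&` [set x | u < x]).
Proof.
move=> /clubE[cl uD]; apply/clubE; split.
  move=> a la; split; first by apply: cl; apply: limpt_sub la => x [].
  have [b ba] := la.1; have [x [[_ /= ux] _ xa]] := la.2 _ ba.
  exact: lt_trans xa.
move=> v; have [x Dx] := uD (Order.max u v); rewrite gt_max => /andP[ux vx].
by exists x.
Qed.

Lemma club_rec (E : set K -> set K) :
  exists D : K -> set K, forall i, D i = [set x | forall j, j < i -> E (D j) x].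
Proof.
pose F (i : K) (r : forall j : K, j < i -> set K) :=
  [set x | forall (j : K) (ji : j < i), E (r j ji) x].
exists (Fix (wo_wf Kwo) (fun _ => set K) F) => i; rewrite Fix_eq//.
move=> x f g fg; congr F; apply: functional_extensionality_dep => y.
by apply: functional_extensionality_dep => yx; apply: fg.
Qed.

End Clubs.

(** * Moving the guessing onto [S] *)

Section Guessing.
Context {d : Order.disp_t} {K : orderType d}.
Hypothesis Kreg : regular_cardinal K.
Hypothesis Knomax : ~ has_ubound [set: K].
Hypothesis K2 : card_ge_aleph K 2.

Let Kwo : well_order (<=%O : rel K). Proof. by case: Kreg. Qed.

(* [w] plays the role of omega_1: the least ordinal with uncountably many predecessors. *)
Lemma omega1_exists : exists w : K, [/\ ~ countable (below w),
  ~ ([set: K] #<= below w) & 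
  forall s : nat -> K, (forall n, s n < w) -> exists2 b, b < w & forall n, s n < b].
Proof.
have [w nw wmin] := wo_min Kwo (uncountable_below Kreg Knomax K2).
exists w; split=> //; first by case: Kreg.
move=> s sw; apply: contrapT => H; apply: nw.
have cb b : b < w -> countable (below b).
  by move=> bw; apply: contrapT => /wmin; rewrite leNgt bw.
(* An unbounded [s] would write [below w] as a countable union of countable sets. *)
suff -> : below w = \bigcup_(n in [set: nat]) (below (s n) `|` [set s n]).
  apply: bigcup_countable => // n _; rewrite -bigcup2E; apply: bigcup_countable => //.
  by move=> [|[|k]] _ /=; [exact: cb | exact: countable1 | exact: countable0].
apply/seteqP; split=> [x xw|x [n _ [xs|->]]]; last 2 first.
- exact: lt_trans (sw n).
- exact: sw.
apply: contrapT => nx; apply: H; exists x => // n.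
rewrite lt_neqAle leNgt; apply/andP; split; last first.
  by apply/negP => xs; apply: nx; exists n => //; left.
by apply/eqP => xs; apply: nx; exists n => //; right.
Qed.

Lemma move_guessing (e : K -> set K) (S T : set K) : C_sequence e -> coherent e ->
  guesses_clubs e setT T -> stationary S ->
  exists X, guesses_clubs (refine e X) S T.
Proof.
move=> eC eco eg Sst; apply: contrapT => nG.
(* [E] is chosen for every set [D], so the recursions below can run on arbitrary sets. *)
have /choice[E EP] : forall D, exists E, club E /\ forall δ, S δ ->
    ~ limpt (nacc (refine e (D `&` T) δ) `&` E `&` T) δ.
  move=> D; apply: contrapT => H; apply: nG; exists (D `&` T) => D' cD'.
  apply: contrapT => nδ; apply: H; exists D'; split=> // δ Sδ lδ; apply: nδ.
  exists δ => //; apply/positive_sup_below => // x [[/naccE[rx _] _] _].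
  exact: (refine_below eC rx).
have [w [cw Kw wreg]] := omega1_exists.
have Kunc : ~ countable [set: K].
  by move=> cK; apply: cw; apply: card_le_trans (subset_card_le (@subsetT _ _)) cK.
have [D DE] := club_rec Kreg E.
pose D2 n := iter n (fun D => D `&` E D) setT.
pose DD := (\bigcap_(i in below w) E (D i)) `&` (\bigcap_(n in [set: nat]) E (D2 n)).
have cDD : club DD.
  by apply: club_setI => //; apply: club_bigcap => // i _; apply: (EP _).1.
pose A := [set t | limpt (nacc (e t) `&` DD `&` T) t].
have /(club_limpt Kreg Knomax Kunc)/Sst[δ [Sδ lδ]] : ~ has_ubound A.
  apply/nhas_uboundE => u; have [t _] := eg _ (club_above u cDD).
  rewrite positive_sup_below => [lt|x [[/naccE[ex _] _] _]]; last exact: (e_below eC ex).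
  exists t; first by apply: limpt_sub lt => x [[nx [Dx _]] Tx]; split.
  have [b bt] := lt.1; have [x [[[_ [_ /= ux]] _] _ xt]] := lt.2 _ bt.
  exact: lt_trans xt.
have Q1 a : a < δ -> exists2 i, i < w & forall j, j < w -> i <= j -> exists x,
    [/\ nacc (refine e (D j `&` T) δ) x, (forall i, i < w -> E (D i) x), T x, a < x & x < δ].
  move=> aδ; have W0 : below w !=set0.
    by apply/set0P/negP => /eqP w0; apply: cw; rewrite w0; apply: countable0.
  have anti i j : i <= j -> D j `&` T `<=` D i `&` T.
    move=> ij x [Dx Tx]; split=> //; move: Dx; rewrite !DE => Dx k ki.
    by apply: Dx; apply: lt_le_trans ij.
  have AG t : A t -> limpt (nacc (e t) `&` \bigcap_(i in below w) (D i `&` T)) t.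
    apply: limpt_sub => x [[nx [Dx _]] Tx]; split=> // i iw; split=> //; rewrite DE => k ki.
    by apply: Dx; apply: lt_trans iw.
  have [i iw H] := antitone_refine_nacc Kwo eC eco W0 anti AG lδ aδ.
  exists i => // j jw ij; have [x [nx Dx ax xδ]] := H j jw ij; exists x; split=> //.
    (* A constant sequence: some [b < w] lies above [k], so [D b] is contained in [E (D k)]. *)
    move=> k kw; have [b bw kb] := wreg (fun=> k) (fun=> kw).
    by have [] := Dx b bw; rewrite DE => /(_ k (kb 0%N)).
  by have [] := Dx i iw.
have Q2 a : a < δ -> exists n : nat, exists x,
    [/\ nacc (refine e (D2 n `&` T) δ) x, (forall i, E (D2 i) x), T x, a < x & x < δ].
  move=> aδ; have W0 : [set: nat] !=set0 by exists 0%N.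
  have anti i j : i <= j -> D2 j `&` T `<=` D2 i `&` T.
    rewrite leEnat => /subnK <-; elim: (j - i)%N => [//|k IHk] x [[Dx _] Tx].
    exact: IHk.
  have AG t : A t -> limpt (nacc (e t) `&` \bigcap_(i in [set: nat]) (D2 i `&` T)) t.
    apply: limpt_sub => x [[nx [_ Dx]] Tx]; split=> // i _; split=> //.
    by elim: i => [//|i IHi]; split=> //; apply: Dx.
  have [i _ H] := antitone_refine_nacc Kwo eC eco W0 anti AG lδ aδ.
  have [x [nx Dx ax xδ]] := H i I (lexx i); exists i, x; split=> //.
    by move=> k; have [[]] := Dx k.+1 I.
  by have [] := Dx i I.
(* [eps n] witnesses that the refinement by [D2 n] fails to guess [E (D2 n)] at [δ]. *)
have /choice[eps epsP] : forall n, exists b, b < δ /\ forall x,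
    nacc (refine e (D2 n `&` T) δ) x -> E (D2 n) x -> T x -> x < δ -> x <= b.
  move=> n; apply: contrapT => H; have [_ /(_ _ Sδ)] := EP (D2 n); apply.
  split; first by case: lδ.
  move=> b bδ; apply: contrapT => H'; apply: H; exists b; split=> // x nx Ex Tx xδ.
  by rewrite leNgt; apply/negP => bx; apply: H'; exists x.
have /choice[i iP] : forall n, exists i, i < w /\ forall j, j < w -> i <= j -> exists x,
    [/\ nacc (refine e (D j `&` T) δ) x, (forall i, i < w -> E (D i) x), T x, eps n < x & x < δ].
  by move=> n; have [i] := Q1 _ (epsP n).1; exists i.
(* One index [j < w] beyond all [i n] supplies good points above every [eps n] at once. *)
have [j jw ij] := wreg i (fun n => (iP n).1).
have [_ /(_ _ Sδ)] := EP (D j); apply; split; first by case: lδ.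
(* [Q2] puts [a] below some [eps n], so the [eps n] are cofinal in [δ]; the points supplied by [j]
   then contradict the choice of [E (D j)]. *)
move=> a /Q2[n [x [nx Ex Tx ax xδ]]].
have ae := lt_le_trans ax ((epsP n).2 x nx (Ex n) Tx xδ).
have [y [ny Ey Ty ey yδ]] := (iP n).2 j jw (ltW (ij n)).
by exists y; split=> //; [split=> //; split=> //; apply: Ey | exact: lt_trans ey].
Qed.
End Guessing.

Theorem theorem3p18 (d : Order.disp_t) (K : orderType d)
  (K_regular : regular_cardinal K) (K_ge_aleph2 : card_ge_aleph K 2)
  (T : set K) (T_stationary : stationary T)
  (e_exists : exists e : K -> set K,
     [/\ C_sequence e, coherent e & guesses_clubs e setT T]) :
  forall S : set K, stationary S ->
    exists C : K -> set K,
      [/\ C_sequence C, coherent C & guesses_clubs C S T].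
Proof.
move=> S Sst; have [e [eC eco eg]] := e_exists.
have [Kub|Knub] := pselect (has_ubound [set: K]).
  (* A junk case: if [K] had a maximum there would be no clubs at all. *)
  exists e; split=> // D [_ nD]; case: nD.
  exact: subset_has_ubound Kub.
have Kwo : well_order (<=%O : rel K) by case: K_regular.
have [X Xg] := move_guessing K_regular Knub K_ge_aleph2 eC eco eg Sst.
exists (refine e X); split=> //; first exact: refine_C_sequence.
exact: refine_coherent.
Qed.
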